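(* Let $f=2$, $d=0$, and $t>2$. Then there is no discreet strategy for the parameters $(t,f,d)=(t,2,0)$.
   Context: There are $t$ distinguishable coins, identified with a set $T$ with $|T|=t$. All real coins weigh the same, all fake coins weigh the same, and a fake coin is lighter than a real one. Exactly $f$ coins are fake; the lawyer knows the true set $F\subset T$ of fake coins, $|F|=f$. The judge only knows in advance that the number of fake coins is either $f$ or $d$ ($d\neq f$, $0\le d\le t$). A weighing places $n\ge 1$ coins on the left pan and $n$ other coins on the right pan of a balance scale; its outcome is one of ''balanced'', ''left pan lighter'', ''right pan lighter'' (the pan with more fake coins is lighter; the pans balance if they contain equally many fake coins). For a finite sequence of weighings performed with true fake set $F$, a set $S\subseteq T$ is consistent if, were $S$ the set of fake coins, every weighing would have the same outcome as it has for $F$. A strategy for $(t,f,d)$ is a choice of $F$ with $|F|=f$ and a finite sequence of weighings that proves to the judge that there are exactly $f$ fake coins, i.e. no set $S$ with $|S|=d$ is consistent. It is discreet if no information about any particular coin is revealed: for every coin $c\in T$ there is a consistent set $S$ with $|S|=f$ and $c\in S$, and also a consistent set $S'$ with $|S'|=f$ and $c\notin S'$. *)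

(* Defs.v *)
From mathcomp Require Import all_boot.

Set Implicit Arguments.
Unset Strict Implicit.
Unset Printing Implicit Defensive.

Record weighing (T : finType) := Weighing {
  left_pan : {set T};
  right_pan : {set T};
  pans_nonempty : 0 < #|left_pan|;
  pans_card : #|left_pan| = #|right_pan|;
  pans_disjoint : [disjoint left_pan & right_pan]
}.

Variant outcome := Balanced | LeftLighter | RightLighter.

(* Fake coins are lighter, and the pans hold equally many coins, so the pan
   with more coins of the fake set S is the lighter one. *)
Definition weigh (T : finType) (S : {set T}) (w : weighing T) : outcome :=
  let l := #|left_pan w :&: S| in
  let r := #|right_pan w :&: S| in
  if l == r then Balanced else if r < l then LeftLighter else RightLighter.

Definition consistent (T : finType) (F : {set T}) (ws : seq (weighing T))
    (S : {set T}) : Prop :=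
  [seq weigh S w | w <- ws] = [seq weigh F w | w <- ws].

(* The number t of coins is #|T|.  The weighings form a fixed list: the lawyer
   knows F, hence all outcomes, in advance. *)
Record strategy (T : finType) (f d : nat) := Strategy {
  fake : {set T};
  weighings : seq (weighing T);
  card_fake : #|fake| = f;
  strategy_proves : forall S : {set T},
    #|S| = d -> ~ consistent fake weighings S
}.

Definition discreet (T : finType) (f d : nat) (s : strategy T f d) : Prop :=
  forall c : T,
    (exists S : {set T},
       [/\ #|S| = f, consistent (fake s) (weighings s) S & c \in S]) /\
    (exists S' : {set T},
       [/\ #|S'| = f, consistent (fake s) (weighings s) S' & c \notin S']).

(* Main.v *)
Require Import Defs.
From mathcomp Require Import all_boot.

(** If no coin were fake, every weighing would balance.  Hence a strategy
    that refutes zero fake coins must contain an unbalanced weighing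
    ([unbalanced_witness]).  The heavier pan of that weighing cannot hold a
    coin of any consistent pair: the lighter pan would then need at least two
    coins of the pair, for a total of at least three ([heavier_pan_avoids]).
    So every coin on the heavier pan, which is nonempty, is revealed to be
    real, and the strategy is not discreet. *)

Lemma weigh_set0 (T : finType) (w : weighing T) : weigh set0 w = Balanced.
Proof. by rewrite /weigh !setI0 eqxx. Qed.

(** Besides being unbalanced, the weighing found here must have the same
    outcome for all consistent sets.  Stating this directly stands in for
    membership of the weighing in the list, as weighings carry no decidable
    equality. *)
Lemma unbalanced_witness (T : finType) (F : {set T}) (ws : seq (weighing T)) :
  ~ consistent F ws set0 ->
  exists w : weighing T, weigh F w <> Balanced /\
    forall S : {set T}, consistent F ws S -> weigh S w = weigh F w.
Proof.
elim: ws => [|w ws IH] notcons0; first by case: notcons0.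
have balanced_or_witness : weigh F w = Balanced \/ weigh F w <> Balanced.
  by case: (weigh F w); [left | right | right].
case: balanced_or_witness => [bal | unbal]; last first.
  by exists w; split=> // S [].
have [|v [unbal_v same_v]] := IH.
  by move=> cons0; apply: notcons0; rewrite /consistent /= weigh_set0 bal cons0.
by exists v; split=> // S [_ /same_v].
Qed.

Lemma heavier_pan_avoids (T : finType) (L H S : {set T}) (c : T) :
  [disjoint L & H] -> #|S| = 2 -> #|H :&: S| < #|L :&: S| -> c \in H ->
  c \notin S.
Proof.
move=> disLH cardS lt_HL cH; apply/negP => cS.
have H_gt0 : 0 < #|H :&: S| by apply/card_gt0P; exists c; rewrite inE cH.
have disj : (L :&: S) :&: (H :&: S) = set0.
  by rewrite -setIIl (disjoint_setI0 disLH) set0I.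
have : #|L :&: S| + #|H :&: S| <= 2.
  rewrite -cardsUI disj cards0 addn0 -setIUl -cardS.
  by apply: subset_leq_card; exact: subsetIr.
by rewrite leqNgt (leq_add (leq_ltn_trans H_gt0 lt_HL) H_gt0).
Qed.

Theorem lemma3 (t : nat) (T : finType) (cardT : #|T| = t) (t_gt2 : 2 < t) :
  ~ (exists s : strategy T 2 0, discreet s).
Proof.
case=> s disc.
have [w [unbal same]] := unbalanced_witness _ _ _ (strategy_proves (s := s) (cards0 T)).
have disLR := pans_disjoint w.
have L_gt0 := pans_nonempty w.
have R_gt0 : 0 < #|right_pan w| by rewrite -pans_card.
case outF: (weigh (fake s) w) unbal same => // _ same.
- have [c cR] := card_gt0P R_gt0.
  have [[S [cardS /same outS cS]] _] := disc c.
  have lt_RL : #|right_pan w :&: S| < #|left_pan w :&: S|.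
    by move: outS; rewrite /weigh; case: ltngtP.
  by move: (heavier_pan_avoids _ _ _ _ _ disLR cardS lt_RL cR); rewrite cS.
- have [c cL] := card_gt0P L_gt0.
  have [[S [cardS /same outS cS]] _] := disc c.
  have lt_LR : #|left_pan w :&: S| < #|right_pan w :&: S|.
    by move: outS; rewrite /weigh; case: ltngtP.
  rewrite disjoint_sym in disLR.
  by move: (heavier_pan_avoids _ _ _ _ _ disLR cardS lt_LR cL); rewrite cS.
Qed.
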